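(* Let $m,n$ be positive integers and $\alpha_1,\dots,\alpha_m\ge0$ integers with $\sum_i i\alpha_i=n$. For $\pi\in\mathcal{PF}_{m,n}$ let $\mathrm{vstr}(\pi)$ be the labeled lattice configuration in the $m\times(n+m)$ grid obtained as follows: if column $x$ ($0\le x\le m-1$) of $\pi$ contains $h_x$ cars, column $x$ of $\mathrm{vstr}(\pi)$ contains $h_x+1$ cars (the path has $h_x+1$ north steps at abscissa $x$); the lowest cell of each column contains one of the cars $1,\dots,m$, these being assigned so that $\mathrm{rank}(1)>\mathrm{rank}(2)>\dots>\mathrm{rank}(m)$ in $\mathrm{vstr}(\pi)$; and above it, column $x$ contains the cars $i+m$ for the cars $i$ of column $x$ of $\pi$, in the same bottom-to-top order. Then $\mathrm{vstr}$ restricts to a bijection $$\{\pi\in\mathcal{PF}_{m,n}:\mathrm{pides}(\pi)=m^{\alpha_m}\cdots1^{\alpha_1}\}\to\{\pi\in\mathcal{PF}_{m,n+m}:\mathrm{pides}(\pi)=m^{\alpha_m+1}(m-1)^{\alpha_{m-1}}\cdots1^{\alpha_1}\},$$ and $\mathrm{area}(\mathrm{vstr}(\pi))=\mathrm{area}(\pi)$, $\mathrm{dinv}(\mathrm{vstr}(\pi))=\mathrm{dinv}(\pi)$, $\mathrm{ret}(\mathrm{vstr}(\pi))=\mathrm{ret}(\pi)$.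
   Context: An $(m,n)$-Dyck path is a north/east lattice path from $(0,0)$ to $(m,n)$ weakly above $y=\frac nm x$. An $(m,n)$-parking function $\pi$ is such a path $\Pi(\pi)$ whose $n$ north steps are labeled bijectively by $1,\dots,n$ (cars, in the cells just right of the north steps), increasing upward in each column; $\mathcal{PF}_{m,n}$ is the set. With $d=\gcd(m,n)$, cell $(x,y)$ (lower-left corner) has rank $my-nx+\lfloor xd/m\rfloor$; a car's rank is that of its cell. $\mathrm{ides}(\pi)=\{i:\mathrm{rank}(i)<\mathrm{rank}(i+1)\}=\{i_1<\dots<i_r\}$, $\mathrm{pides}(\pi)=(i_1,i_2-i_1,\dots,n-i_r)$; $m^{\alpha_m}\cdots1^{\alpha_1}$ denotes the composition with $\alpha_m$ parts $m$, then $\alpha_{m-1}$ parts $m-1$, …, then $\alpha_1$ parts $1$. $\mathrm{area}$ = number of full cells between path and diagonal. $\lambda(P)$ = partition (English) of cells of the rectangle above $P$; $\mathrm{arm}(c),\mathrm{leg}(c)$ as usual; $\mathrm{pdinv}(P)=\#\{c:\frac{\mathrm{arm}(c)}{\mathrm{leg}(c)+1}\le\frac mn<\frac{\mathrm{arm}(c)+1}{\mathrm{leg}(c)}\}$ ($x/0=\infty$); $\mathrm{tdinv}(\pi)=\#\{i<j:\mathrm{rank}(i)<\mathrm{rank}(j)<\mathrm{rank}(i)+m\}$; $\mathrm{maxdinv}(P)$ = maximum tdinv over parking functions on $P$; $\mathrm{dinv}=\mathrm{tdinv}+\mathrm{pdinv}-\mathrm{maxdinv}$. With $(m,n)=(km_0,kn_0)$,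 $\gcd(m_0,n_0)=1$, $\mathrm{ret}(\pi)$ is the least $i\ge1$ with the path through $(im_0,in_0)$. *)

(* Defs.v *)
From mathcomp Require Import all_boot all_order all_algebra.
From mathcomp Require Import classical_sets functions.

Set Implicit Arguments.
Unset Strict Implicit.
Unset Printing Implicit Defensive.

Import Order.TTheory GRing.Theory Num.Theory.

(* A north/east lattice path from the origin is its word of steps. *)
Definition path_word := seq bool.
Notation north := true (only parsing).
Notation east := false (only parsing).

Definition points (P : path_word) : seq (nat * nat) :=
  [seq (count_mem east (take j P), count_mem north (take j P))
  | j <- iota 0 (size P).+1].

Definition dyck (m n : nat) (P : path_word) : bool :=
  [&& count_mem east P == m, count_mem north P == n
    & all (fun p => n * p.1 <= m * p.2) (points P)].

Fixpoint norths_from (x : nat) (P : path_word) : seq nat :=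
  match P with
  | [::] => [::]
  | s :: P' => if s then x :: norths_from x P' else norths_from x.+1 P'
  end.

(* The abscissae of the north steps, from bottom to top: the y-th north step
   joins (x, y) to (x, y + 1) where x = nth 0 (norths P) y.  Hence the cell
   (x, y) is to the left of (i.e. above) the path iff x < nth 0 (norths P) y. *)
Definition norths (P : path_word) : seq nat := norths_from 0 P.

Definition heights (m : nat) (P : path_word) : seq nat :=
  [seq count_mem x (norths P) | x <- iota 0 m].

(* A labelled path: a path together with the labels of its north steps, listed
   along the path (hence from bottom to top). *)
Definition labelled_path := (path_word * seq nat)%type.

(* The cars of the columns 0, ..., m - 1, each column read upward. *)
Definition columns (m : nat) (pi : labelled_path) : seq (seq nat) :=
  reshape (heights m pi.1) pi.2.

Definition parking (m n : nat) (pi : labelled_path) : bool :=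
  [&& dyck m n pi.1, perm_eq pi.2 (iota 1 n)
    & all (sorted ltn) (columns m pi)].

Definition cell_rank (m n x y : nat) : int :=
  (Posz (m * y) - Posz (n * x) + Posz ((x * gcdn m n) %/ m))%R.

Definition car_rank (m n : nat) (pi : labelled_path) (i : nat) : int :=
  let y := index i pi.2 in cell_rank m n (nth 0 (norths pi.1) y) y.

Definition ides (m n : nat) (pi : labelled_path) : seq nat :=
  [seq i <- iota 1 n.-1 | (car_rank m n pi i < car_rank m n pi i.+1)%R].

Definition pides (m n : nat) (pi : labelled_path) : seq nat :=
  pairmap (fun a b => b - a) 0 (rcons (ides m n pi) n).

(* m^(alpha m) ... 1^(alpha 1); only alpha 1, ..., alpha m are used. *)
Definition composition_of (m : nat) (alpha : nat -> nat) : seq nat :=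
  flatten [seq nseq (alpha i) i | i <- rev (iota 1 m)].

(* The cell (x, y) lies entirely above the diagonal iff its lower right corner
   (x + 1, y) lies weakly above it. *)
Definition area (m n : nat) (P : path_word) : nat :=
  \sum_(x < m) \sum_(y < n)
    ((nth 0 (norths P) y <= x) && (n * x.+1 <= m * y)).

(* English convention: the parts are the lengths of the rows of cells above P,
   read from the top row downward (trailing zero parts are kept). *)
Definition partition_of (P : path_word) : seq nat := rev (norths P).

Definition arm (la : seq nat) (r c : nat) : nat := nth 0 la r - c.+1.

Definition leg (la : seq nat) (r c : nat) : nat :=
  count (fun part => c < part) (drop r.+1 la).

Definition pdinv_cell (m n a l : nat) : bool :=
  ((a%:R / l.+1%:R <= m%:R / n%:R :> rat) &&
   ((l == 0%N) || (m%:R / n%:R < a.+1%:R / l%:R :> rat)))%R.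

Definition pdinv (m n : nat) (P : path_word) : nat :=
  let la := partition_of P in
  \sum_(0 <= r < size la) \sum_(0 <= c < nth 0 la r)
    pdinv_cell m n (arm la r c) (leg la r c).

Definition tdinv (m n : nat) (pi : labelled_path) : nat :=
  \sum_(1 <= i < n.+1) \sum_(i.+1 <= j < n.+1)
    ((car_rank m n pi i < car_rank m n pi j)%R &&
     (car_rank m n pi j < car_rank m n pi i + m%:R)%R).

Definition maxdinv (m n : nat) (P : path_word) : nat :=
  \max_(s <- permutations (iota 1 n) | parking m n (P, s)) tdinv m n (P, s).

Definition dinv (m n : nat) (pi : labelled_path) : int :=
  (Posz (tdinv m n pi) + Posz (pdinv m n pi.1) - Posz (maxdinv m n pi.1))%R.

(* The search succeeds for every path from (0, 0) to (m, n), at the latest at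
   i = gcd(m, n). *)
Definition ret (m n : nat) (P : path_word) : nat :=
  let k := gcdn m n in
  (find (fun i => (i * (m %/ k), i * (n %/ k)) \in points P) (iota 1 k)).+1.

(* For columns listed from left to right, the labelled path having these
   columns. *)
Definition of_columns (cols : seq (seq nat)) : labelled_path :=
  (flatten [seq rcons (nseq (size c) north) east | c <- cols], flatten cols).

(* Rank, in the m x (n + m) grid, of the lowest cell of column x once every
   column has received one more car: the columns on its left contain
   sumn (take x (heights m P)) + x cars. *)
Definition bottom_rank (m n : nat) (P : path_word) (x : nat) : int :=
  cell_rank m (n + m) x (sumn (take x (heights m P)) + x).

(* The columns in decreasing order of bottom_rank: the i-th one receives the
   car i.  Distinct columns have distinct bottom ranks. *)
Definition bottom_order (m n : nat) (P : path_word) : seq nat :=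
  sort (fun x x' => (bottom_rank m n P x' <= bottom_rank m n P x)%R) (iota 0 m).

Definition vstr (m n : nat) (pi : labelled_path) : labelled_path :=
  of_columns
    [seq (index x (bottom_order m n pi.1)).+1
           :: [seq i + m | i <- nth [::] (columns m pi) x]
    | x <- iota 0 m].

(* Main.v *)
Require Import Defs.
From mathcomp Require Import all_boot all_order all_algebra.
From mathcomp Require Import classical_sets functions.
From mathcomp Require Import zify.
Local Open Scope classical_set_scope.

Set Implicit Arguments.
Unset Strict Implicit.
Unset Printing Implicit Defensive.

Import Order.TTheory GRing.Theory Num.Theory.

(* Let h x be the height of column x, Y x the number of cars to the left of
   column x and g x = m Y x - n x.  Adding one car to each column turns Y x into
   Y x + x and n into n + m, so g and the rank of the bottom cell of each column
   do not change, while the rank of every old car increases by m.  Hence area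
   and ret are preserved, and the cars 1, ..., m contribute one new first part m
   to pides.  Conversely, a first part m says that the ranks of the cars
   1, ..., m decrease, so no two of them share a column: they are exactly the
   lowest cars of the m columns, and can be removed.

   For dinv, numbering the cells of a path by increasing rank makes every pair of
   cells with 0 < rank v - rank u < m count, so maxdinv is the number of such
   pairs.  Under vstr, maxdinv - tdinv therefore grows by the number of these
   pairs with v a bottom cell, that is by
     #{c < x : g c - g (x + 1) <= m + n and g x - g (c + 1) < m + n},
   whereas a cell by cell comparison of arms and legs shows that pdinv grows by
     #{c < x : g (c + 1) - g (x + 1) <= m + n and g x - g (c + 1) < m + n}.
   For fixed x at most one of the two inequalities fails for a given c, and the
   first one never fails for g 0 and for g x, so shifting c by one shows that the
   two counts agree. *)

(** * Lattice paths and the abscissae of their north steps *)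

(** This is [Y x] in the notation above: the ordinate at which column [x] starts when [h] gives the
    column heights. *)
Definition hsum (h : nat -> nat) (x : nat) : nat := \sum_(0 <= w < x) h w.

Lemma hsumS h x : hsum h x.+1 = hsum h x + h x.
Proof. by rewrite /hsum big_nat_recr. Qed.

Lemma hsum0 h : hsum h 0 = 0.
Proof. exact: big_geq. Qed.

Lemma leq_hsum h x y : x <= y -> hsum h x <= hsum h y.
Proof.
move=> /subnK <-; elim: (y - x) => [|k IH] //.
by rewrite addSn hsumS (leq_trans IH) // leq_addr.
Qed.

Lemma eq_hsum h k x : {in gtn x, h =1 k} -> hsum h x = hsum k x.
Proof. by move=> e; apply: eq_big_nat => w /andP[_ lt]; exact: e. Qed.

Lemma hsum_succ h x : hsum (fun w => (h w).+1) x = hsum h x + x.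
Proof. by elim: x => [|x IH]; rewrite ?hsum0 ?hsumS ?IH //; lia. Qed.

Lemma ltn_hsum h m x t : x < m -> t < h x -> hsum h x + t < hsum h m.
Proof.
by move=> lx lt; rewrite (leq_trans _ (leq_hsum h lx)) // hsumS -addnS leq_add2l.
Qed.

(** The value of [norths] on a path with column heights [h] and width [m]; see
    [norths_of_columns]. *)
Definition stairs (h : nat -> nat) (m : nat) : seq nat :=
  flatten [seq nseq (h x) x | x <- iota 0 m].

Lemma stairsS h m : stairs h m.+1 = stairs h m ++ nseq (h m) m.
Proof. by rewrite /stairs -addn1 iotaD map_cat flatten_cat /= cats0. Qed.

Lemma size_stairs h m : size (stairs h m) = hsum h m.
Proof.
by elim: m => [|m IH]; rewrite ?stairsS ?hsumS ?size_cat ?size_nseq ?IH ?hsum0.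
Qed.

Lemma stairs_lt h m : all (gtn m) (stairs h m).
Proof.
apply/allP => y /flatten_mapP[x]; rewrite mem_iota => /andP[_ lt].
by move=> /nseqP[->].
Qed.

Lemma take_stairs h m x t : x < m -> t <= h x ->
  take (hsum h x + t) (stairs h m) = stairs h x ++ nseq t x.
Proof.
move=> + le; elim: m => // m IH; rewrite ltnS stairsS leq_eqVlt => /orP[/eqP<-|lt].
  by rewrite take_cat size_stairs ltnNge leq_addr /= addKn take_nseq.
rewrite takel_cat ?IH // size_stairs (leq_trans _ (leq_hsum _ lt)) // hsumS.
by rewrite leq_add2l.
Qed.

Lemma nth_stairs h m x t : x < m -> t < h x ->
  nth 0 (stairs h m) (hsum h x + t) = x.
Proof.
move=> lx lt; rewrite -(nth_take 0 (ltnSn _)) -addnS take_stairs //.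
by rewrite nth_cat size_stairs ltnNge leq_addr addKn nth_nseq ltnSn.
Qed.

Lemma count_lt_stairs h m c : c <= m -> count (gtn c) (stairs h m) = hsum h c.
Proof.
elim: m => [|m IH]; first by rewrite leqn0 => /eqP->; rewrite hsum0.
rewrite leq_eqVlt => /orP[/eqP->|lt]; last first.
  by rewrite stairsS count_cat count_nseq /= IH // ltnNge -ltnS lt addn0.
by rewrite -(size_stairs h m.+1); apply/eqP; rewrite -all_count stairs_lt.
Qed.

(** This count supplies the legs in [pdinv_stairs]. *)
Lemma count_gt_stairs h x c : c < x ->
  count (ltn c) (stairs h x) = hsum h x - hsum h c.+1.
Proof.
move=> lt; rewrite -size_stairs -(count_predC (gtn c.+1) (stairs h x)).
rewrite count_lt_stairs // addKn; apply: eq_count => y /=.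
by rewrite -leqNgt.
Qed.

(** Each row [y] is written uniquely as [hsum h x + t] with [t < h x]; this turns sums over rows
    into sums over columns and positions in them. *)
Lemma sum_stairs h m (F : nat -> nat -> nat) :
  \sum_(0 <= y < hsum h m) F y (nth 0 (stairs h m) y) =
  \sum_(0 <= x < m) \sum_(0 <= t < h x) F (hsum h x + t) x.
Proof.
elim: m => [|m IH]; first by rewrite hsum0 !big_geq.
rewrite big_nat_recr //= -IH hsumS (big_cat_nat (leq0n _) (leq_addr _ _)) /=.
congr addn.
  apply: eq_big_nat => y /andP[_ lt].
  by rewrite stairsS nth_cat size_stairs lt.
rewrite -{1}[hsum h m]add0n big_addn addKn; apply: eq_big_nat => t /andP[_ lt].
rewrite stairsS nth_cat size_stairs ltnNge leq_addl /= addnK nth_nseq lt.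
by rewrite addnC.
Qed.

Lemma count_gtn_eq0 (s : seq nat) x : all (leq x) s -> count (gtn x) s = 0.
Proof.
move=> le; apply/eqP; rewrite -leqn0 leqNgt -has_count -all_predC.
by apply: sub_all le => y /=; rewrite -leqNgt.
Qed.

(** In a sorted list the entries at most [x] form an initial segment, whose length is the count on
    the right. *)
Lemma sorted_nth_leq (s : seq nat) x y : sorted leq s -> y < size s ->
  (nth 0 s y <= x) = (y < count (gtn x.+1) s).
Proof.
elim: s y => // a s IH y srt lt.
have le : all (leq a) s := order_path_min leq_trans srt.
have [gt|ax] := ltnP x a.
  rewrite count_gtn_eq0 ?ltn0 /=; last first.
    by rewrite gt; apply: sub_all le => z; exact: leq_trans.
  apply/negbTE; rewrite -ltnNge; case: y lt => //= y lt.
  exact: leq_trans gt (all_nthP 0 le _ lt).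
rewrite -cat1s count_cat /= ltnS ax add1n; case: y lt => [|y] lt /=.
  by rewrite ax.
by rewrite ltnS IH // (path_sorted srt).
Qed.

Lemma norths_fromE x P : norths_from x P = map (addn x) (norths P).
Proof.
rewrite /norths -{1}[x]addn0; elim: P 0 => //= -[] P IH y /=; rewrite -?addnS IH ?addn0 //.
Qed.

Lemma norths_from_cat x P Q :
  norths_from x (P ++ Q) = norths_from x P ++ norths_from (x + count_mem false P) Q.
Proof.
elim: P x => [|[] P IH] x /=; rewrite ?addn0 ?IH ?add0n //.
by rewrite addSnnS.
Qed.

Lemma size_norths P : size (norths P) = count_mem true P.
Proof. by rewrite /norths; elim: P 0 => //= -[] P IH x /=; rewrite IH. Qed.

Lemma sorted_norths P : sorted leq (norths P).
Proof.
rewrite /norths; suff: path leq 0 (norths_from 0 P) by move/path_sorted.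
elim: P 0 => //= -[] P IH x /=; first by rewrite leqnn IH.
by apply: (@path_le _ leq leq_trans x x.+1).
Qed.

Lemma points_cons s P :
  points (s :: P) = (0, 0) :: [seq (p.1 + ~~ s, p.2 + s) | p <- points P].
Proof.
have e : iota 0 (size P).+2 = 0 :: [seq j.+1 | j <- iota 0 (size P).+1].
  by rewrite -(iotaDl 1 0).
rewrite /points [size (s :: P)]/= e map_cons -!map_comp; congr cons.
apply: eq_map => j /=.
by case: s; rewrite /= ?add0n ?addn0 add1n addn1.
Qed.

(** On each vertical line the path covers one segment. Induction on the first step: a north step
    shifts all ordinates by one, an east step all abscissae. *)
Lemma mem_points P x y :
  ((x, y) \in points P) =
  [&& x <= count_mem false P, count (gtn x) (norths P) <= y
    & y <= count (gtn x.+1) (norths P)].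
Proof.
have c0 s : count (gtn 0) s = 0 by rewrite count_gtn_eq0 //; apply/allP.
elim: P x y => [|s P IH] x y.
  by rewrite /points /= inE xpair_eqE !leqn0.
rewrite points_cons inE xpair_eqE; case: s.
  have -> : ((x, y) \in [seq (p.1 + ~~ true, p.2 + true) | p <- points P]) =
     (0 < y) && ((x, y.-1) \in points P).
    apply/mapP/idP => [[[a b] ab [-> ->]]|/andP[y0 xy]].
      by rewrite addn0 addn1 /=.
    by exists (x, y.-1); rewrite //= addn0 addn1 prednK.
  have -> : norths (true :: P) = [:: 0] ++ norths P by [].
  rewrite IH !count_cat /=; case: x => [|x]; rewrite ?c0; lia.
have -> : ((x, y) \in [seq (p.1 + ~~ false, p.2 + false) | p <- points P]) =
   (0 < x) && ((x.-1, y) \in points P).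
  apply/mapP/idP => [[[a b] ab [-> ->]]|/andP[y0 xy]].
    by rewrite addn1 /= addn0.
  by exists (x.-1, y); rewrite //= addn0 addn1 prednK.
have -> : norths (false :: P) = map (addn 1) (norths P) by exact: (norths_fromE 1 P).
have cS c : count (gtn c.+1) (map (addn 1) (norths P)) = count (gtn c) (norths P).
  by rewrite count_map; apply: eq_count => z /=; rewrite add1n ltnS.
rewrite IH cS; case: x => [|x]; rewrite ?cS ?c0 /=; lia.
Qed.

(** The lowest point on each vertical line is the critical one, so one inequality per abscissa
    suffices. *)
Lemma dyckP m n P :
  reflect [/\ count_mem false P = m, count_mem true P = n
    & forall x, x <= m -> n * x <= m * count (gtn x) (norths P)] (dyck m n P).
Proof.
apply: (iffP and3P) => [[/eqP em /eqP en /allP H]|[em en H]].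
  split=> // x le; apply: (H (x, _)).
  rewrite mem_points em le leqnn /=; apply: sub_count => z /=; lia.
split; rewrite ?em ?en //; apply/allP => -[x y] /=.
rewrite mem_points em => /and3P[le1 le2 _].
by apply: leq_trans (H _ le1) _; rewrite leq_mul2l le2 orbT.
Qed.

(** * Paths and parking functions as lists of columns *)

Definition height (cols : seq (seq nat)) (x : nat) : nat :=
  size (nth [::] cols x).

Lemma sumn_shape cols x : sumn (take x (shape cols)) = hsum (height cols) x.
Proof.
elim: x => [|x IH]; first by rewrite take0 hsum0.
rewrite hsumS -IH; have [lt|le] := ltnP x (size (shape cols)).
  rewrite (take_nth 0) // sumn_rcons /height (nth_map [::]) //.
  by rewrite -(size_map size).
rewrite !take_oversize ?(leqW le) //.
by rewrite /height nth_default ?addn0 // -(size_map size).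
Qed.

Lemma size_flatten_cols cols : size (flatten cols) = hsum (height cols) (size cols).
Proof. by rewrite size_flatten -sumn_shape take_oversize // size_map. Qed.

Lemma count_easts_of_columns cols : count_mem false (of_columns cols).1 = size cols.
Proof.
rewrite /of_columns /=; elim: cols => //= a c IH.
by rewrite count_cat -cats1 count_cat count_nseq /= IH.
Qed.

Lemma norths_of_columns cols :
  norths (of_columns cols).1 = stairs (height cols) (size cols).
Proof.
elim/last_ind: cols => [|cols c IH] //.
rewrite /norths /of_columns /= map_rcons -cats1 flatten_cat norths_from_cat.
rewrite [norths_from 0 _]IH (count_easts_of_columns cols) add0n size_rcons stairsS /= cats0; congr (_ ++ _).
  congr flatten; apply/eq_in_map => x; rewrite mem_iota => /andP[_ lt].
  by rewrite /height nth_rcons lt.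
rewrite /height nth_rcons ltnn eqxx.
by elim: (size c) (size cols) => //= k IHk x; rewrite IHk.
Qed.

Lemma count_norths_of_columns cols :
  count_mem true (of_columns cols).1 = size (flatten cols).
Proof. by rewrite -size_norths norths_of_columns size_stairs size_flatten_cols. Qed.

Lemma count_stairs_eq h m x : x < m -> count_mem x (stairs h m) = h x.
Proof.
elim: m => // m IH; rewrite ltnS stairsS count_cat count_nseq /= leq_eqVlt.
case/orP=> [/eqP->|lt]; last by rewrite IH // gtn_eqF // addn0.
rewrite eqxx mul1n (_ : count_mem m _ = 0) //.
apply/count_memPn/negP => mm.
by have /allP/(_ _ mm) := stairs_lt h m; rewrite /= ltnn.
Qed.

Lemma heights_of_columns cols :
  heights (size cols) (of_columns cols).1 = shape cols.
Proof.
rewrite /heights norths_of_columns; apply: (@eq_from_nth _ 0).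
  by rewrite !size_map size_iota.
move=> x; rewrite size_map size_iota => lt.
by rewrite !(nth_map 0) ?size_iota // (nth_map [::]) // nth_iota // count_stairs_eq.
Qed.

Lemma columns_of_columns cols : columns (size cols) (of_columns cols) = cols.
Proof. by rewrite /columns heights_of_columns flattenK. Qed.

(** Parking functions seen as lists of columns, with the Dyck condition tested at the foot of each
    column. [parking_of_columns] and [parking_cols] pass between the two descriptions. *)
Definition wf_columns (m n : nat) (cols : seq (seq nat)) :=
  [/\ size cols = m, perm_eq (flatten cols) (iota 1 n), all (sorted ltn) cols
    & forall x, x <= m -> n * x <= m * hsum (height cols) x].

Lemma parking_of_columns m n cols :
  wf_columns m n cols -> parking m n (of_columns cols).
Proof.
case=> sz pe srt H; apply/and3P; split => //.
  apply/dyckP; split.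
  - by rewrite count_easts_of_columns.
  - by rewrite count_norths_of_columns (perm_size pe) size_iota.
  - by move=> x le; rewrite norths_of_columns sz count_lt_stairs // H.
by rewrite -sz columns_of_columns.
Qed.

(** The hypothesis forbids north steps after the last east step, so the word splits into blocks of
    north steps, each closed by an east step. *)
Lemma word_of_norths x P : all (gtn (x + count_mem false P)) (norths_from x P) ->
  P = flatten [seq rcons (nseq (count_mem w (norths_from x P)) true) false
              | w <- iota x (count_mem false P)].
Proof.
elim: P x => [|[] P IH] x //=.
  rewrite add0n => /andP[lt /IH eP]; rewrite {1}eP.
  move: lt; case e: (count_mem false P) => [|k]; first by rewrite addn0 ltnn.
  move=> _ /=; rewrite eqxx /=; congr (_ :: (_ ++ flatten _)).
  apply/eq_in_map => w; rewrite mem_iota => /andP[lt _].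
  by rewrite (ltn_eqF lt).
rewrite addnA addn1 => /IH eP; rewrite {1}eP add0n.
rewrite (_ : count_mem x _ = 0) //.
by apply/count_memPn; rewrite norths_fromE; apply/mapP => -[y _]; lia.
Qed.

Lemma of_columns_word cols :
  (of_columns cols).1 = flatten [seq rcons (nseq k true) false | k <- shape cols].
Proof. by rewrite /shape -map_comp. Qed.

Lemma dyck_word m n P : 0 < m -> dyck m n P ->
  P = flatten [seq rcons (nseq k true) false | k <- heights m P]
  /\ sumn (heights m P) = n.
Proof.
move=> m0 /dyckP[em en H].
have lt : all (gtn m) (norths P).
  (* The Dyck inequality at abscissa [m] forces all [n] north steps to lie strictly to the left of
     it. *)
  have := H m (leqnn _); rewrite mulnC leq_pmul2l // all_count size_norths en => le.
  by rewrite eqn_leq le -en -size_norths count_size.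
have eP : P = flatten [seq rcons (nseq k true) false | k <- heights m P].
  by rewrite {1}[P](@word_of_norths 0) em ?add0n // /heights -map_comp.
(* Dummy columns of the right sizes bring the sum of the heights under [count_norths_of_columns]. *)
split=> //; set c := [seq nseq k 0 | k <- heights m P].
have sh : shape c = heights m P.
  by rewrite /shape -map_comp map_id_in // => k _ /=; rewrite size_nseq.
by rewrite -sh -size_flatten -count_norths_of_columns of_columns_word sh -eP.
Qed.

Lemma parking_cols m n pi : 0 < m -> parking m n pi ->
  pi = of_columns (columns m pi) /\ wf_columns m n (columns m pi).
Proof.
case: pi => P s m0 /and3P[/= dP pe srt].
have [eP sn] := dyck_word m0 dP.
have ss : size s = n by rewrite (perm_size pe) size_iota.
have sh : shape (columns m (P, s)) = heights m P by rewrite reshapeKl ?sn ?ss.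
have fl : flatten (columns m (P, s)) = s by rewrite reshapeKr ?sn ?ss.
have E : (P, s) = of_columns (columns m (P, s)).
  by rewrite [RHS]surjective_pairing of_columns_word sh -eP /= fl.
have sz : size (columns m (P, s)) = m.
  by rewrite -(size_map size) -/(shape _) sh size_map size_iota.
split=> //; split; rewrite ?fl // => x le.
have /dyckP[_ _ /(_ x le)] := dP; rewrite [P in norths P](f_equal fst E).
by rewrite norths_of_columns sz count_lt_stairs.
Qed.

(** * Ranks *)

Lemma cell_rankD m n x y t :
  cell_rank m n x (y + t) = (cell_rank m n x y + (m * t)%:Z)%R.
Proof. rewrite /cell_rank mulnDr; lia. Qed.

(** The gcd does not change and the two terms [m * x] cancel. This is why adding one car to every
    column keeps the rank of each column's foot. *)
Lemma cell_rank_addn m n x y : cell_rank m (n + m) x (y + x) = cell_rank m n x y.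
Proof. rewrite /cell_rank gcdnDr mulnDr mulnDl; lia. Qed.

Lemma divn_gcdn m n x : 0 < m -> (x * gcdn m n) %/ m = x %/ (m %/ gcdn m n).
Proof.
move=> m0; have d0 : 0 < gcdn m n by rewrite gcdn_gt0 m0.
by rewrite -[in X in _ %/ X = _](divnK (dvdn_gcdl m n)) divnMr.
Qed.

(** The rest of the rank is a multiple of the gcd, so a correction below the gcd only breaks
    ties. *)
Lemma divn_gcdn_lt m n x : 0 < m -> x < m -> (x * gcdn m n) %/ m < gcdn m n.
Proof.
move=> m0 lt; have d0 : 0 < gcdn m n by rewrite gcdn_gt0 m0.
by rewrite ltn_divLR // mulnC ltn_pmul2l.
Qed.

Lemma cell_rank_inj m n x x' y y' : 0 < m -> x < m -> x' < m ->
  cell_rank m n x y = cell_rank m n x' y' -> x = x'.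
Proof.
wlog le : x x' y y' / x <= x' => [hw|] m0 lx lx' e.
  have [le|/ltnW le] := leqP x x'; first exact: hw e.
  by apply/esym; apply: hw (esym e).
set d := gcdn m n; have d0 : 0 < d by rewrite gcdn_gt0 m0.
have em : m = m %/ d * d by rewrite divnK ?dvdn_gcdl.
have en : n = n %/ d * d by rewrite divnK ?dvdn_gcdr.
have fx := divn_gcdn_lt n m0 lx; have fx' := divn_gcdn_lt n m0 lx'.
have : m * y + n * x' + (x * d) %/ m = m * y' + n * x + (x' * d) %/ m.
  by move: e; rewrite /cell_rank -/d; lia.
have dm k : d %| m * k by rewrite dvdn_mulr ?dvdn_gcdl.
have dn k : d %| n * k by rewrite dvdn_mulr ?dvdn_gcdr.
(* Modulo the gcd only the floor terms survive, and both are smaller than the gcd. *)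
move=> E; have ef : (x * d) %/ m = (x' * d) %/ m.
  have := f_equal (modn^~ d) E.
  have d0mod a b : (m * a + n * b) %% d = 0 by apply/eqP/dvdn_add.
  by rewrite -modnDml -[RHS]modnDml !d0mod !add0n !modn_small.
have {E} E : m * y + n * (x' - x) = m * y'.
  by move: E; rewrite ef => /addIn E; rewrite mulnBr addnBA ?leq_mul // E addnK.
(* Now [m] divides [n * (x' - x)]; dividing by the gcd leaves coprime factors. *)
have : m %/ d %| x' - x.
  have co : coprime (m %/ d) (n %/ d).
    rewrite /coprime -(eqn_pmul2r d0) mul1n.
    by rewrite muln_gcdl -em -en.
  rewrite -(Gauss_dvdr _ co) -(dvdn_pmul2r d0) mulnAC -em -en.
  by rewrite -(dvdn_addr _ (dvdn_mulr y (dvdnn m))) E dvdn_mulr.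
(* The abscissae have the same quotient and the same remainder modulo [m %/ d]. *)
move: ef; rewrite !divn_gcdn // => ef dv.
by have := divn_eq x (m %/ d); have := divn_eq x' (m %/ d); move: dv;
  rewrite -eqn_mod_dvd // => /eqP ->; rewrite ef => <- <-.
Qed.

(** The floor term is at least as large in the right-hand column, so ties go against a strict
    inequality here. Conversely, a strict inequality between multiples of the gcd leaves a gap of at
    least the gcd, which exceeds the correction. *)
Lemma cell_rank_lt m n c x y z : c < x -> x < m ->
  (cell_rank m n x y < cell_rank m n c z)%R = (m * y + n * c < m * z + n * x).
Proof.
move=> lt lx; have m0 : 0 < m by case: m lx.
have fx := divn_gcdn_lt n m0 lx.
have le : (c * gcdn m n) %/ m <= (x * gcdn m n) %/ m.
  by rewrite leq_div2r // leq_mul2r (ltnW lt) orbT.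
move: le fx; rewrite /cell_rank.
move: ((c * gcdn m n) %/ m) ((x * gcdn m n) %/ m) => fc fx' le fx.
apply/idP/idP; first by lia.
move=> h; have : m * y + n * c + gcdn m n <= m * z + n * x.
  have dA : gcdn m n %| m * y + n * c by rewrite dvdn_add // dvdn_mulr ?dvdn_gcdl ?dvdn_gcdr.
  have dB : gcdn m n %| m * z + n * x by rewrite dvdn_add // dvdn_mulr ?dvdn_gcdl ?dvdn_gcdr.
  have : gcdn m n %| (m * z + n * x) - (m * y + n * c) by rewrite dvdn_sub.
  by move/dvdn_leq; rewrite subn_gt0 => /(_ h); lia.
lia.
Qed.

(** Negation of [cell_rank_lt], equal ranks being excluded in distinct columns. *)
Lemma cell_rank_gt m n c x y z : c < x -> x < m ->
  (cell_rank m n c z < cell_rank m n x y)%R = (m * z + n * x <= m * y + n * c).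
Proof.
move=> lt lx; have m0 : 0 < m by case: m lx.
rewrite leqNgt -(cell_rank_lt _ _ _ lt lx) -leNgt le_eqVlt orb_idl // => /eqP e.
by have := cell_rank_inj m0 (ltn_trans lt lx) lx e; lia.
Qed.

(** * Area, returns and pdinv *)

Lemma sum_indicator_widen (p : pred nat) a b : a <= b ->
  \sum_(0 <= y < b) ((y < a) && p y) = \sum_(0 <= y < a) p y.
Proof.
move=> le; rewrite (big_cat_nat (leq0n a) le) /= [X in _ + X]big_nat_cond.
rewrite [X in _ + X]big1 ?addn0 => [|y /andP[/andP[ge _] _]]; last by rewrite ltnNge ge.
by apply: eq_big_nat => y /andP[_ ->].
Qed.

Lemma area_stairs m n P h : norths P = stairs h m -> hsum h m = n ->
  area m n P = \sum_(0 <= x < m) \sum_(0 <= y < hsum h x.+1) (n * x.+1 <= m * y).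
Proof.
move=> eN en; rewrite /area big_mkord; apply: eq_bigr => x _.
have le : hsum h x.+1 <= n by rewrite -en leq_hsum.
rewrite -[RHS](sum_indicator_widen _ le) big_mkord; apply: eq_bigr => y _.
rewrite sorted_nth_leq ?sorted_norths //; last by rewrite eN size_stairs en.
by rewrite eN count_lt_stairs.
Qed.

Lemma area_stairs_succ m n P P' h : hsum h m = n ->
  norths P = stairs h m -> norths P' = stairs (fun x => (h x).+1) m ->
  area m (n + m) P' = area m n P.
Proof.
move=> en eN eN'; rewrite (area_stairs eN) // (area_stairs eN') ?hsum_succ ?en //.
apply: eq_big_nat => x /andP[_ lx]; rewrite hsum_succ addnC.
rewrite (big_cat_nat (leq0n _) (leq_addr _ _)) /=.
(* The lowest [x.+1] rows of column [x] of the taller grid contain no cell entirely above the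
   diagonal; the other rows match those of the old grid. *)
rewrite big_nat_cond big1 ?add0n => [|y /andP[/andP[_ lt] _]]; last first.
  apply/eqP; rewrite eqb0 -ltnNge mulnDl ltn_addl // ltn_pmul2l //.
  exact: leq_ltn_trans lx.
rewrite (big_addn 0 _ x.+1) addKn; apply: eq_bigr => y _.
by rewrite mulnDl mulnDr leq_add2r.
Qed.

(** The path stays weakly above the diagonal, so it can meet a diagonal point only at its lowest
    point on that vertical line. *)
Lemma mem_points_diagonal m n h P i : 0 < m -> dyck m n P -> norths P = stairs h m ->
  i <= gcdn m n ->
  ((i * (m %/ gcdn m n), i * (n %/ gcdn m n)) \in points P) =
  (hsum h (i * (m %/ gcdn m n)) == i * (n %/ gcdn m n)).
Proof.
move=> m0 /dyckP[em _ H] eN; set d := gcdn m n => le.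
set x := i * (m %/ d); set y := i * (n %/ d).
have d0 : 0 < d by rewrite gcdn_gt0 m0.
have xm : x <= m by rewrite /x -[X in _ <= X](divnK (dvdn_gcdl m n)) mulnC leq_mul2l le orbT.
have E : n * x = m * y.
  rewrite /x /y mulnCA [RHS]mulnCA; congr (i * _).
  by rewrite !muln_divA ?dvdn_gcdl ?dvdn_gcdr // mulnC.
have {}H := H _ xm; move: (H); rewrite E leq_pmul2l // eN count_lt_stairs // => ge.
rewrite mem_points em xm eN count_lt_stairs //= eqn_leq ge andbT.
case: leqP => //= lt; apply: leq_trans ge _; rewrite -(count_lt_stairs h xm).
by apply: sub_count => z /= /ltnW.
Qed.

(** At abscissa [i * (m %/ d)], with [d] the common gcd, both the path and the diagonal gain exactly
    that abscissa in height. *)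
Lemma ret_stairs_succ m n P P' h : 0 < m -> dyck m n P -> dyck m (n + m) P' ->
  norths P = stairs h m -> norths P' = stairs (fun x => (h x).+1) m ->
  ret m (n + m) P' = ret m n P.
Proof.
move=> m0 dP dP' eN eN'; rewrite /ret gcdnDr; congr _.+1.
apply: eq_in_find => i; rewrite mem_iota add1n ltnS => /andP[_ le].
have := mem_points_diagonal m0 dP' eN'; rewrite gcdnDr => -> //.
rewrite (mem_points_diagonal m0 dP eN) // hsum_succ divnDr ?dvdn_gcdl //.
by rewrite mulnDr eqn_add2r.
Qed.

(** [pdinv_cell] with denominators cleared; for [l = 0] the second inequality holds automatically
    once [0 < n], as the convention on infinity requires. *)
Definition pdinv_window (m n a l : nat) : bool :=
  (n * a <= m * l.+1) && (m * l < n * a.+1).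

Lemma pdinv_cellE m n a l : 0 < n -> pdinv_cell m n a l = pdinv_window m n a l.
Proof.
move=> n0; rewrite /pdinv_cell /pdinv_window; congr andb.
  rewrite ler_pdivrMr ?ltr0n // mulrAC ler_pdivlMr ?ltr0n // -!natrM ler_nat.
  by rewrite mulnC.
case: l => [|l] /=; first by rewrite muln0 muln_gt0 n0.
by rewrite ltr_pdivrMr ?ltr0n // mulrAC ltr_pdivlMr ?ltr0n // -!natrM ltr_nat [n * _]mulnC.
Qed.

(** The cell in column [c] and in the row of the [t]-th north step of column [x] has arm [x - c.+1].
    Its leg counts the earlier north steps to the right of column [c]. *)
Lemma pdinv_stairs m n P h : 0 < n -> norths P = stairs h m ->
  pdinv m n P = \sum_(0 <= x < m) \sum_(0 <= c < x) \sum_(0 <= t < h x)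
     pdinv_window m n (x - c.+1) (hsum h x + t - hsum h c.+1).
Proof.
move=> n0 eN; rewrite /pdinv /partition_of eN size_rev size_stairs.
(* The partition lists its rows from the top, while [stairs] lists them from the bottom. *)
rewrite big_nat_rev add0n /=.
under eq_big_nat => y lt.
  have e : hsum h m - (hsum h m - y.+1).+1 = y by lia.
  have le : y <= hsum h m by lia.
  have -> : nth 0 (rev (stairs h m)) (hsum h m - y.+1) = nth 0 (stairs h m) y.
    by rewrite nth_rev size_stairs ?e //; lia.
  under eq_big_nat => c lc.
    rewrite /arm /leg nth_rev size_stairs; last by lia.
    rewrite e drop_rev size_stairs count_rev e pdinv_cellE //.
    over.
  over.
pose F y x := \sum_(0 <= c < x) pdinv_window m n (x - c.+1) (count (ltn c) (take y (stairs h m))).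
transitivity (\sum_(0 <= y < hsum h m) F y (nth 0 (stairs h m) y)) => //.
rewrite sum_stairs; apply: eq_big_nat => x /andP[_ lx].
rewrite exchange_big; apply: eq_big_nat => c /andP[_ lc].
apply: eq_big_nat => t /andP[_ lt].
rewrite take_stairs ?(ltnW lt) // count_cat count_gt_stairs // count_nseq /= lc mul1n.
by rewrite addnBAC // leq_hsum.
Qed.

(** For fixed [a] the admissible [t] form an interval. In the taller grid the interval and the range
    of [t] both gain one point at the upper end, so the count grows by one exactly when the new
    interval meets the new range. *)
Lemma pdinv_window_sum_succ m n a L h :
  \sum_(0 <= t < h.+1) pdinv_window m (n + m) a (L + a + t) =
  \sum_(0 <= t < h) pdinv_window m n a (L + t)
  + ((n * a <= m * (L + h).+1) && (m * L < n * a.+1 + m)).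
Proof.
have W t : pdinv_window m (n + m) a (L + a + t) =
  (n * a <= m * (L + t).+1) && (m * (L + t) < n * a.+1 + m).
  by rewrite /pdinv_window; congr andb; lia.
elim: h => [|h IH].
  by rewrite big_nat1 big_geq // W addn0.
rewrite big_nat_recr //= {}IH big_nat_recr //= W /pdinv_window !addnS !mulnS.
have := leq_mul (leqnn m) (leq_addr h L); lia.
Qed.

(** This and [short_rise] are the inequalities [g c - g (x + 1) <= m + n] and
    [g x - g (c + 1) < m + n], with negative terms moved across so as to stay in [nat]. *)
Definition short_gap (m n : nat) (h : nat -> nat) (c x : nat) : bool :=
  m * hsum h c + n * x <= m * hsum h x.+1 + m + n * c.

Definition short_rise (m n : nat) (h : nat -> nat) (c x : nat) : bool :=
  m * hsum h x + n * c < m * hsum h c.+1 + m + n * x.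

Lemma pdinv_stairs_succ m n P P' h : 0 < n ->
  norths P = stairs h m -> norths P' = stairs (fun x => (h x).+1) m ->
  (forall x, x <= m -> n * x <= m * hsum h x) ->
  pdinv m (n + m) P' =
  pdinv m n P + \sum_(0 <= x < m) \sum_(0 <= c < x)
                  (short_gap m n h c x && short_rise m n h c x).
Proof.
move=> n0 eN eN' H.
rewrite (pdinv_stairs n0 eN) (pdinv_stairs _ eN') ?addn_gt0 ?n0 // -big_split /=.
apply: eq_big_nat => x /andP[_ lx].
(* The comparison of cells yields [short_gap] at [c.+1]; the index is shifted to [c] afterwards. *)
transitivity (\sum_(0 <= c < x)
   (\sum_(0 <= t < h x)
      pdinv_window m n (x - c.+1) (hsum h x + t - hsum h c.+1)
    + (short_gap m n h c.+1 x && short_rise m n h c x))).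
  apply: eq_big_nat => c /andP[_ lc].
  have le := leq_hsum h lc.
  transitivity (\sum_(0 <= t < (h x).+1) pdinv_window m (n + m) (x - c.+1)
      ((hsum h x - hsum h c.+1) + (x - c.+1) + t)).
    by apply: eq_bigr => t _; rewrite !hsum_succ; congr pdinv_window; lia.
  set L := hsum h x - hsum h c.+1; set a := x - c.+1.
  have eL : hsum h x = L + hsum h c.+1 by rewrite subnK.
  have ex : n * x = n * a + (n * c + n) by rewrite -mulnSr -mulnDr subnK.
  rewrite pdinv_window_sum_succ; congr (_ + nat_of_bool (_ && _)).
  - by apply: eq_bigr => t _; rewrite addnBAC.
  - by rewrite /short_gap [hsum h x.+1]hsumS ex eL; lia.
  - by rewrite /short_rise ex eL; lia.
rewrite big_split /=; congr addn.
(* The two boundary terms of the telescoping sum; the first rests on the Dyck condition at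
   [x.+1]. *)
have A0 : short_gap m n h 0 x.
  rewrite /short_gap hsum0 !muln0 addn0; apply: leq_trans (leq_addr _ _).
  by apply: leq_trans (H _ lx); rewrite leq_mul2l leqnSn orbT.
have Ax : short_gap m n h x x.
  by rewrite /short_gap leq_add2r -[X in X <= _]addn0 leq_add // leq_mul2l leq_hsum ?orbT.
suff tele k : k <= x -> 
  \sum_(0 <= c < k) (short_gap m n h c.+1 x && short_rise m n h c x) + short_gap m n h 0 x =
  \sum_(0 <= c < k) (short_gap m n h c x && short_rise m n h c x) + short_gap m n h k x.
  by have := tele x (leqnn x); rewrite A0 Ax => /addIn.
elim: k => [|k IH] lk; first by rewrite !big_geq.
rewrite !big_nat_recr //= addnAC {}IH ?(ltnW lk) // -!addnA; congr addn.
(* If [short_rise] holds, the two sides agree by commutativity; if it fails, both gap conditions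
   hold and each side is 1. *)
have : short_gap m n h k x || short_rise m n h k x.
  have := leq_mul (leqnn m) (leq_hsum h (leqnSn k)).
  have := leq_mul (leqnn m) (leq_hsum h (leqnSn x)).
  rewrite /short_gap /short_rise; lia.
have : short_gap m n h k.+1 x || short_rise m n h k x.
  have := leq_mul (leqnn m) (leq_hsum h (leqnSn x)).
  rewrite /short_gap /short_rise; lia.
by case: (short_gap m n h k x); case: (short_gap m n h k.+1 x); case: short_rise.
Qed.

(** * tdinv and maxdinv *)

Definition close (m : nat) (a b : int) : bool := ((a < b) && (b < a + m%:R))%R.

Lemma sum_square_triangle m (G : nat -> nat -> nat) : (forall x, G x x = 0) ->
  \sum_(0 <= x < m) \sum_(0 <= c < m) G x c =
  \sum_(0 <= x < m) \sum_(0 <= c < x) (G x c + G c x).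
Proof.
move=> G0; elim: m => [|m IH]; first by rewrite !big_geq.
rewrite !(big_nat_recr m) //= -IH G0 addn0 big_split /= [in RHS]addnCA [LHS]addnC; congr addn.
by rewrite -big_split /=; apply: eq_bigr => x _; rewrite big_nat_recr.
Qed.

(** Ranks grow by [m] up a column, so at most one of its cells is close below a given rank. One
    exists when that rank lies between the first cell and the cell just past the last; equality
    cannot occur in distinct columns. *)
Lemma sum_close m n c x y z k : c != x -> c < m -> x < m ->
  \sum_(0 <= s < k) close m (cell_rank m n c (z + s)) (cell_rank m n x y) =
  (cell_rank m n c z < cell_rank m n x y < cell_rank m n c (z + k))%R.
Proof.
move=> neq lc lx; have m0 := leq_ltn_trans (leq0n _) lx.
have dis s : cell_rank m n c (z + s) <> cell_rank m n x y.
  by move/(cell_rank_inj m0 lc lx) => e; rewrite e eqxx in neq.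
elim: k => [|k IH].
  by rewrite big_geq // addn0; case: ltgtP.
rewrite big_nat_recr //= {}IH /close.
have := dis k; have := dis 0; rewrite !cell_rankD muln0 mulnS; lia.
Qed.

(** For two columns, only the one with the higher foot can contribute. The order of the feet implies
    one of the two inequalities, and the other is what [sum_close] tests. *)
Lemma sum_close_bottoms m n h :
  \sum_(0 <= x < m) \sum_(0 <= c < m) \sum_(0 <= s < (h c).+1)
     close m (cell_rank m n c (hsum h c + s)) (cell_rank m n x (hsum h x)) =
  \sum_(0 <= x < m) \sum_(0 <= c < x) (short_gap m n h c x && short_rise m n h c x).
Proof.
rewrite sum_square_triangle => [|x]; last first.
  by apply: big1 => s _; rewrite cell_rankD /close; lia.
apply: eq_big_nat => x /andP[_ lx]; apply: eq_big_nat => c /andP[_ lc].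
have lcm := ltn_trans lc lx; have m0 := leq_ltn_trans (leq0n _) lx.
rewrite !sum_close //; try by rewrite ?(ltn_eqF lc) ?(gtn_eqF lc).
have dis : cell_rank m n c (hsum h c) <> cell_rank m n x (hsum h x).
  by move/(cell_rank_inj m0 lcm lx); lia.
have -> : short_rise m n h c x =
    (cell_rank m n x (hsum h x) < cell_rank m n c (hsum h c + (h c).+1))%R.
  by rewrite cell_rank_lt // /short_rise hsumS addnS mulnS [m + _]addnC.
have -> : short_gap m n h c x =
    (cell_rank m n c (hsum h c) < cell_rank m n x (hsum h x + (h x).+1))%R.
  by rewrite cell_rank_gt // /short_gap hsumS addnS mulnS [m + _]addnC.
rewrite !cell_rankD; lia.
Qed.

(** Pairs of cells are sorted into three classes: the second is a bottom cell, only the first is, or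
    neither is. *)
Lemma sum_cells_succ m (h : nat -> nat) (F : nat -> nat -> nat -> nat -> nat) :
  \sum_(0 <= x < m) \sum_(0 <= t < (h x).+1)
    \sum_(0 <= c < m) \sum_(0 <= s < (h c).+1) F x t c s =
  \sum_(0 <= x < m) \sum_(0 <= t < (h x).+1) \sum_(0 <= c < m) F x t c 0
  + \sum_(0 <= x < m) \sum_(0 <= c < m) \sum_(0 <= s < h c) F x 0 c s.+1
  + \sum_(0 <= x < m) \sum_(0 <= t < h x)
      \sum_(0 <= c < m) \sum_(0 <= s < h c) F x t.+1 c s.+1.
Proof.
rewrite -addnA -!big_split /=; apply: eq_bigr => x _.
have E t : \sum_(0 <= c < m) \sum_(0 <= s < (h c).+1) F x t c s =
   \sum_(0 <= c < m) F x t c 0 + \sum_(0 <= c < m) \sum_(0 <= s < h c) F x t c s.+1.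
  by rewrite -big_split /=; apply: eq_bigr => c _; rewrite big_nat_recl.
rewrite (eq_bigr _ (fun t _ => E t)) big_split /=; congr addn.
by rewrite big_nat_recl.
Qed.

(** The label-free count of pairs, which turns out to be [maxdinv]. *)
Definition close_pairs (m n : nat) (h : nat -> nat) : nat :=
  \sum_(0 <= x < m) \sum_(0 <= t < h x) \sum_(0 <= c < m) \sum_(0 <= s < h c)
    close m (cell_rank m n x (hsum h x + t)) (cell_rank m n c (hsum h c + s)).

(** Pairs in the enlarged path of a bottom cell and a higher-ranked old car, written in the old
    coordinates. Both [tdinv] and [maxdinv] grow by this number. *)
Definition close_above_bottoms (m n : nat) (h : nat -> nat) : nat :=
  \sum_(0 <= x < m) \sum_(0 <= c < m) \sum_(0 <= s < h c)
    close m (cell_rank m n x (hsum h x)) (cell_rank m n c (hsum h c + s.+1)).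

Lemma cell_rank_succ m n h x t :
  cell_rank m (n + m) x (hsum (fun w => (h w).+1) x + t) =
  cell_rank m n x (hsum h x + t).
Proof. by rewrite hsum_succ addnAC cell_rank_addn. Qed.

Lemma close_cell_rankS m n c x y z :
  close m (cell_rank m n c y.+1) (cell_rank m n x z.+1) =
  close m (cell_rank m n c y) (cell_rank m n x z).
Proof.
rewrite -(addn1 y) -(addn1 z) !cell_rankD /close muln1; lia.
Qed.

Lemma close_pairs_succ m n h :
  close_pairs m (n + m) (fun x => (h x).+1) =
  close_pairs m n h + close_above_bottoms m n h
  + \sum_(0 <= x < m) \sum_(0 <= c < x) (short_gap m n h c x && short_rise m n h c x).
Proof.
rewrite -sum_close_bottoms {1}/close_pairs sum_cells_succ [LHS]addnC [LHS]addnCA [LHS]addnC; congr (_ + _ + _).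
- apply: eq_bigr => x _; apply: eq_bigr => t _; apply: eq_bigr => c _; apply: eq_bigr => s _.
  by rewrite !cell_rank_succ !addnS close_cell_rankS.
- apply: eq_bigr => x _; apply: eq_bigr => c _; apply: eq_bigr => s _.
  by rewrite !cell_rank_succ addn0.
rewrite [RHS]exchange_big; apply: eq_bigr => x _; rewrite exchange_big.
apply: eq_bigr => c _; apply: eq_bigr => t _.
by rewrite !cell_rank_succ addn0.
Qed.

Definition label (cols : seq (seq nat)) (x t : nat) : nat :=
  nth 0 (nth [::] cols x) t.

Lemma labelP cols i : i \in flatten cols ->
  exists x t, [/\ x < size cols, t < height cols x & i = label cols x t].
Proof.
case/flattenP => c /(nthP [::])[x lx <-] /(nthP 0)[t lt <-].
by exists x, t.
Qed.

Lemma label_mem cols x t : x < size cols -> t < height cols x ->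
  label cols x t \in flatten cols.
Proof. by move=> lx lt; apply/flattenP; exists (nth [::] cols x); rewrite mem_nth. Qed.

Lemma heightE cols x : height cols x = nth 0 (shape cols) x.
Proof.
rewrite /height /shape; have [lt|le] := ltnP x (size cols).
  by rewrite (nth_map [::]).
by rewrite !nth_default ?size_map.
Qed.

Lemma nth_flatten_cols cols x t : t < height cols x ->
  nth 0 (flatten cols) (hsum (height cols) x + t) = label cols x t.
Proof.
rewrite heightE => lt; rewrite -sumn_shape -/(flatten_index _ _ _) nth_flatten.
by rewrite ?flatten_indexKl ?flatten_indexKr.
Qed.

Lemma car_rank_of_columns m n cols x t :
  uniq (flatten cols) -> x < size cols -> t < height cols x ->
  car_rank m n (of_columns cols) (label cols x t) =
  cell_rank m n x (hsum (height cols) x + t).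
Proof.
move=> un lx lt.
have lts : hsum (height cols) x + t < size (flatten cols).
  by rewrite size_flatten_cols ltn_hsum.
rewrite /car_rank -nth_flatten_cols //= index_uniq // norths_of_columns.
by rewrite nth_stairs.
Qed.

(** Reindexes a sum over labels by the cells that carry them. *)
Lemma sum_cars m n cols (f : nat -> int -> nat) :
  size cols = m -> perm_eq (flatten cols) (iota 1 n) ->
  \sum_(1 <= i < n.+1) f i (car_rank m n (of_columns cols) i) =
  \sum_(0 <= x < m) \sum_(0 <= t < height cols x)
    f (label cols x t) (cell_rank m n x (hsum (height cols) x + t)).
Proof.
move=> sz pe; rewrite /index_iota subSS subn0 -(perm_big _ pe) /=.
rewrite (big_nth 0) size_flatten_cols sz.
have un : uniq (flatten cols) by rewrite (perm_uniq pe) iota_uniq.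
pose F y x := f (nth 0 (flatten cols) y) (cell_rank m n x y).
transitivity (\sum_(0 <= y < hsum (height cols) m)
  F y (nth 0 (stairs (height cols) m) y)).
  apply: eq_big_nat => y /andP[_ lt].
  by rewrite /car_rank /= index_uniq ?size_flatten_cols ?sz // norths_of_columns sz.
rewrite sum_stairs; apply: eq_big_nat => x /andP[_ lx].
by apply: eq_big_nat => t /andP[_ lt]; rewrite /F nth_flatten_cols.
Qed.

Lemma tdinv_of_columns m n cols :
  size cols = m -> perm_eq (flatten cols) (iota 1 n) ->
  tdinv m n (of_columns cols) =
  \sum_(0 <= x < m) \sum_(0 <= t < height cols x)
    \sum_(0 <= c < m) \sum_(0 <= s < height cols c)
      ((label cols x t < label cols c s) &&
       close m (cell_rank m n x (hsum (height cols) x + t))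
               (cell_rank m n c (hsum (height cols) c + s))).
Proof.
move=> sz pe; rewrite /tdinv.
(* The triangle is first widened to a square, so that both indices can be converted to cells. *)
transitivity (\sum_(1 <= i < n.+1) \sum_(1 <= j < n.+1) ((i < j) &&
  close m (car_rank m n (of_columns cols) i) (car_rank m n (of_columns cols) j))).
  apply: eq_big_nat => i /andP[i0 lt].
  rewrite [in RHS](@big_cat_nat _ _ _ i.+1) //= [X in _ = X + _]big_nat_cond.
  rewrite [X in _ = X + _]big1 ?add0n => [|j /andP[/andP[_ le] _]].
    by apply: eq_big_nat => j /andP[-> _].
  by rewrite ltnNge -ltnS le.
pose f i r := \sum_(1 <= j < n.+1) ((i < j) && close m r (car_rank m n (of_columns cols) j)).
rewrite (sum_cars f sz pe); apply: eq_bigr => x _; apply: eq_bigr => t _.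
exact: (sum_cars (fun j r => (_ < j) && close m _ r) sz pe).
Qed.

Lemma tdinv_le_close_pairs m n cols :
  size cols = m -> perm_eq (flatten cols) (iota 1 n) ->
  tdinv m n (of_columns cols) <= close_pairs m n (height cols).
Proof.
move=> sz pe; rewrite tdinv_of_columns //.
apply: leq_sum => x _; apply: leq_sum => t _; apply: leq_sum => c _; apply: leq_sum => s _.
by case: (_ < _).
Qed.

Lemma eq_close_pairs m n h k : {in gtn m, h =1 k} -> close_pairs m n h = close_pairs m n k.
Proof.
move=> e; have eh x : x < m -> hsum h x = hsum k x.
  by move=> lx; apply: eq_hsum => w lw; apply: e; exact: ltn_trans lw lx.
rewrite /close_pairs; apply: eq_big_nat => x /andP[_ lx].
rewrite e //; apply: eq_bigr => t _; apply: eq_big_nat => c /andP[_ lc].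
by rewrite e //; apply: eq_bigr => s _; rewrite !eh.
Qed.

Lemma count_lt_mono (I : eqType) (r : I -> int) (s : seq I) a b : a \in s -> b \in s ->
  (count (fun z => r z < r a)%R s < count (fun z => r z < r b)%R s) = (r a < r b)%R.
Proof.
have H c d : c \in s -> (r c < r d)%R ->
    count (fun z => r z < r c)%R s < count (fun z => r z < r d)%R s.
  move=> cs lt;  rewrite -addn1; apply: (@leq_trans (count (predU (fun z => r z < r c)%R (pred1 c)) s)).
    have := count_predUI (fun z => r z < r c)%R (pred1 c) s.
    rewrite [count (predI _ _) s](_ : _ = 0) ?addn0 => [->|].
      by rewrite leq_add2l -has_count has_pred1.
    apply/eqP; rewrite -leqn0 leqNgt -has_count; apply/hasPn => z _ /=.
    by apply/negP => /andP[lz /eqP ez]; rewrite ez ltxx in lz.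
  by apply: sub_count => z /= /orP[lz|/eqP->//]; exact: lt_trans lt.
move=> as_ bs; case: (ltgtP (r a) (r b)) => [/(H a b as_)->//|lt|e].
  by apply/negbTE; rewrite -leqNgt ltnW // H.
by rewrite e ltnn.
Qed.

(** Labelling cells by increasing rank makes the label condition of [tdinv] automatic; columns
    increase because ranks do. *)
Lemma close_pairs_attained m n cols : 0 < m -> wf_columns m n cols ->
  exists2 cols', wf_columns m n cols' &
   shape cols' = shape cols /\ tdinv m n (of_columns cols') = close_pairs m n (height cols).
Proof.
move=> m0 [sz pe srt H].
pose N := stairs (height cols) m.
pose r y := cell_rank m n (nth 0 N y) y.
have hm : hsum (height cols) m = n.
  by rewrite -sz -size_flatten_cols (perm_size pe) size_iota.
have szN : size N = n by rewrite size_stairs.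
(* The label of a cell is one more than the number of cells of smaller rank. *)
pose s := [seq (count (fun z => r z < r y)%R (iota 0 n)).+1 | y <- iota 0 n].
have szs : size s = n by rewrite size_map size_iota.
have ns y : y < n -> nth 0 s y = (count (fun z => r z < r y)%R (iota 0 n)).+1.
  by move=> lt; rewrite (nth_map 0) ?size_iota // nth_iota.
have ps : perm_eq s (iota 1 n).
  have us : uniq s.
    rewrite map_inj_in_uniq ?iota_uniq // => a b ai bi [e].
    have [] : ~~ (r a < r b)%R /\ ~~ (r b < r a)%R.
      by rewrite -!(@count_lt_mono _ r (iota 0 n)) // e ltnn.
    rewrite -!leNgt => le1 le2; have {le1 le2} e' : r a = r b by apply/eqP; rewrite eq_le le1 le2.
    have lN y : y \in iota 0 n -> nth 0 N y < m.
      by rewrite mem_iota => /andP[_ lt]; apply: (all_nthP 0 (stairs_lt _ _)); rewrite -/N szN.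
    have eN := cell_rank_inj m0 (lN a ai) (lN b bi) e'.
    move: e'; rewrite /r eN /cell_rank => e'.
    by apply/eqP; rewrite -(eqn_pmul2l m0); lia.
  apply: uniq_perm => //; first exact: iota_uniq.
  apply: (uniq_min_size us _ _).2; last by rewrite szs size_iota.
  move=> _ /mapP[y yi ->]; rewrite mem_iota /= add1n ltnS.
  rewrite -[X in _ < X](size_iota 0 n) -(count_predC (fun z => r z < r y)%R) -[X in X < _]addn0 ltn_add2l.
  by rewrite -has_count; apply/hasP; exists y => //=; rewrite ltxx.
pose cols' := reshape (shape cols) s.
have ssh : sumn (shape cols) = n by rewrite -size_flatten (perm_size pe) size_iota.
have sh : shape cols' = shape cols by rewrite reshapeKl ?szs ?ssh.
have fl : flatten cols' = s by rewrite reshapeKr ?szs ?ssh.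
have eh : height cols' =1 height cols by move=> x; rewrite !heightE sh.
have ehs x : hsum (height cols') x = hsum (height cols) x by apply: eq_hsum => w _.
have sz' : size cols' = m by rewrite -(size_map size) -/(shape _) sh size_map.
have lab x t : x < m -> t < height cols x ->
   [/\ hsum (height cols) x + t < n, label cols' x t = nth 0 s (hsum (height cols) x + t)
    & r (hsum (height cols) x + t) = cell_rank m n x (hsum (height cols) x + t)].
  move=> lx lt; split.
  - by rewrite -hm ltn_hsum.
  - by rewrite -nth_flatten_cols ?eh // ehs fl.
  - by rewrite /r nth_stairs.
have lab_lt x t c u : x < m -> t < height cols x -> c < m -> u < height cols c ->
   (label cols' x t < label cols' c u) =
   (cell_rank m n x (hsum (height cols) x + t) < cell_rank m n c (hsum (height cols) c + u))%R.
  move=> lx lt lc lu; have [l1 -> <-] := lab x t lx lt; have [l2 -> <-] := lab c u lc lu.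
  by rewrite !ns // ltnS count_lt_mono ?mem_iota.
have wf' : wf_columns m n cols'.
  split=> //; first by rewrite fl.
    apply/(all_nthP [::]) => x; rewrite sz' => lx; apply/(sortedP 0) => t lt.
    rewrite -/(height cols' x) eh in lt.
    change (label cols' x t < label cols' x t.+1).
    by rewrite lab_lt ?(ltnW lt) // !cell_rankD mulnS; lia.
  by move=> x le; rewrite ehs H.
exists cols' => //; split=> //; rewrite tdinv_of_columns ?fl //.
rewrite /close_pairs; apply: eq_big_nat => x /andP[_ lx].
rewrite eh; apply: eq_big_nat => t /andP[_ lt].
apply: eq_big_nat => c /andP[_ lc]; rewrite eh; apply: eq_big_nat => u /andP[_ lu].
by rewrite lab_lt // !ehs /close; case: (_ < _)%R.
Qed.

(** The bound holds for every labelling of the path, since all of them share its column heights. *)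
Lemma maxdinv_of_columns m n cols : 0 < m -> wf_columns m n cols ->
  maxdinv m n (of_columns cols).1 = close_pairs m n (height cols).
Proof.
move=> m0 wf; have [sz pe _ _] := wf.
apply/eqP; rewrite eqn_leq; apply/andP; split.
  apply/bigmax_leqP_seq => s _ pk; have [e [sz' pe' _ _]] := parking_cols m0 pk.
  have sh : shape (columns m ((of_columns cols).1, s)) = shape cols.
    by rewrite -!heights_of_columns -e sz sz'.
  rewrite e; apply: leq_trans (tdinv_le_close_pairs sz' pe') _.
  by rewrite (@eq_close_pairs _ _ _ (height cols)) // => x _; rewrite !heightE sh.
have [cols' wf' [sh <-]] := close_pairs_attained m0 wf.
have e : of_columns cols' = ((of_columns cols).1, flatten cols').
  by rewrite [LHS]surjective_pairing !of_columns_word sh.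
rewrite e; apply: (@leq_bigmax_seq _ _ _ (fun s => tdinv m n ((of_columns cols).1, s))).
  by rewrite mem_permutations; case: wf'.
by rewrite -e parking_of_columns.
Qed.

(** * The columns of vstr *)

Lemma bottom_rankE m n cols x : size cols = m -> x < m ->
  bottom_rank m n (of_columns cols).1 x = cell_rank m n x (hsum (height cols) x).
Proof.
by move=> <- lx; rewrite /bottom_rank heights_of_columns sumn_shape cell_rank_addn.
Qed.

Lemma perm_bottom_order m n P : perm_eq (bottom_order m n P) (iota 0 m).
Proof. by rewrite perm_sort. Qed.

Lemma size_bottom_order m n P : size (bottom_order m n P) = m.
Proof. by rewrite size_sort size_iota. Qed.

Lemma index_bottom_order m n P x : (index x (bottom_order m n P) < m) = (x < m).
Proof.
by rewrite -[X in _ < X](size_bottom_order m n P) index_mem mem_sort mem_iota.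
Qed.

Lemma bottom_order_ge m n P x x' : x < m -> x' < m ->
  index x (bottom_order m n P) <= index x' (bottom_order m n P) ->
  (bottom_rank m n P x' <= bottom_rank m n P x)%R.
Proof.
move=> lx lx'; apply: (@sorted_leq_index _ (fun x x' => bottom_rank m n P x' <= bottom_rank m n P x)%R).
- by move=> a b c /= ab bc; exact: le_trans bc ab.
- by move=> a /=.
- by apply: sort_sorted => a b /=; exact: le_total.
- by rewrite mem_sort mem_iota.
- by rewrite mem_sort mem_iota.
Qed.

Definition vstr_columns (m n : nat) (cols : seq (seq nat)) : seq (seq nat) :=
  [seq (index x (bottom_order m n (of_columns cols).1)).+1
     :: [seq i + m | i <- nth [::] cols x]
  | x <- iota 0 m].

Lemma vstr_of_columns m n cols : size cols = m ->
  vstr m n (of_columns cols) = of_columns (vstr_columns m n cols).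
Proof. by move=> sz; rewrite /vstr -[X in columns X]sz columns_of_columns. Qed.

Section VstrColumns.

Variables (m n : nat) (cols : seq (seq nat)).
Hypothesis wf : wf_columns m n cols.

Let h := height cols.
Let vcols := vstr_columns m n cols.
Let bo := bottom_order m n (of_columns cols).1.

Lemma size_vstr_columns : size vcols = m.
Proof. by rewrite size_map size_iota. Qed.

Lemma nth_vstr_columns x : x < m ->
  nth [::] vcols x = (index x bo).+1 :: [seq i + m | i <- nth [::] cols x].
Proof. by move=> lx; rewrite (nth_map 0) ?size_iota // nth_iota. Qed.

Lemma height_vstr_columns x : x < m -> height vcols x = (h x).+1.
Proof. by move=> lx; rewrite /height nth_vstr_columns //= size_map. Qed.

Lemma hsum_vstr_columns x : x <= m -> hsum (height vcols) x = hsum h x + x.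
Proof.
move=> le; rewrite -hsum_succ; apply: eq_hsum => w lw.
by rewrite height_vstr_columns // (leq_trans lw).
Qed.

Lemma label_vstr_columns0 x : x < m -> label vcols x 0 = (index x bo).+1.
Proof. by move=> lx; rewrite /label nth_vstr_columns. Qed.

Lemma label_vstr_columnsS x t : x < m -> t < h x ->
  label vcols x t.+1 = label cols x t + m.
Proof. by move=> lx lt; rewrite /label nth_vstr_columns //= (nth_map 0). Qed.

Lemma label_gt0 x t : x < m -> t < h x -> 0 < label cols x t.
Proof.
case: wf => sz pe _ _ lx lt.
have := @label_mem cols x t; rewrite sz (perm_mem pe) mem_iota.
by move=> /(_ lx lt)/andP[].
Qed.

(** Position [t] is counted from the new bottom car, so an old car at position [t] now sits at
    [t.+1] and its rank has grown by [m]. *)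
Lemma cell_rank_vstr_columns x t : x <= m ->
  cell_rank m (n + m) x (hsum (height vcols) x + t) = cell_rank m n x (hsum h x + t).
Proof. by move=> le; rewrite hsum_vstr_columns // addnAC cell_rank_addn. Qed.

Lemma cell_rank_ge0 x t : x <= m -> (0 <= cell_rank m n x (hsum h x + t))%R.
Proof.
case: wf => _ _ _ H le; rewrite /cell_rank.
by have := H x le; rewrite mulnDr -/h; move: (_ %/ _); lia.
Qed.

End VstrColumns.

Lemma perm_flatten_cons (I : Type) (T : eqType) (f : I -> T) (g : I -> seq T) s :
  perm_eq (flatten [seq f x :: g x | x <- s])
          ([seq f x | x <- s] ++ flatten [seq g x | x <- s]).
Proof.
elim: s => //= x s IH; rewrite perm_cons perm_sym perm_catCA perm_sym.
by rewrite perm_cat2l.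
Qed.

Lemma map_index_id (T : eqType) (s : seq T) : uniq s ->
  [seq index x s | x <- s] = iota 0 (size s).
Proof.
case: s => // x0 s us; apply: (@eq_from_nth _ 0); first by rewrite size_map size_iota.
move=> i; rewrite size_map => lt.
by rewrite (nth_map x0) // index_uniq // nth_iota.
Qed.

Lemma wf_vstr_columns m n cols : wf_columns m n cols ->
  wf_columns m (n + m) (vstr_columns m n cols).
Proof.
move=> wf; have [sz pe srt H] := wf; split.
- exact: size_vstr_columns.
- apply: perm_trans (perm_flatten_cons _ _ _) _.
  (* The bottom cars are the successors of the indices in [bottom_order], hence 1 to [m]; the others
     are the old labels shifted by [m]. *)
  rewrite addnC iotaD perm_cat //.
    rewrite (map_comp succn) (iotaDl 1 0) -(eq_map add1n) perm_map //.
    set bo := bottom_order _ _ _.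
    have pb : perm_eq bo (iota 0 m) := perm_bottom_order _ _ _.
    rewrite -[X in perm_eq _ (iota 0 X)](size_bottom_order m n (of_columns cols).1) -/bo.
    rewrite -map_index_id ?(perm_uniq pb) ?iota_uniq //.
    by rewrite perm_map // perm_sym.
  rewrite [iota (1 + m) n](_ : _ = [seq i + m | i <- iota 1 n]); last first.
    by rewrite addnC iotaDl; apply: eq_map => i; rewrite addnC.
  rewrite -[X in perm_eq X](_ : [seq i + m | i <- flatten cols] = _) ?perm_map //.
  rewrite map_flatten -[in LHS](mkseq_nth [::] cols) sz /mkseq -map_comp.
  by [].
- apply/(all_nthP [::]) => x; rewrite size_vstr_columns => lx.
  rewrite nth_vstr_columns //= path_min_sorted.
    rewrite sorted_map; apply: sub_sorted (all_nthP [::] srt x _); last by rewrite sz.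
    by move=> a b /=; rewrite ltn_add2r.
  apply/allP => _ /mapP[i ic ->]; rewrite /=.
  have : i \in flatten cols.
    by apply/flattenP; exists (nth [::] cols x); rewrite // mem_nth ?sz.
  rewrite (perm_mem pe) mem_iota => /andP[i0 _].
  by have := index_bottom_order m n (of_columns cols).1 x; rewrite lx /=; lia.
- move=> x le; rewrite hsum_vstr_columns // mulnDl mulnDr leq_add2r.
  exact: H.
Qed.

Lemma norths_vstr m n cols : norths (of_columns (vstr_columns m n cols)).1 =
  stairs (fun x => (height cols x).+1) m.
Proof.
rewrite norths_of_columns size_vstr_columns; congr flatten.
by apply/eq_in_map => x; rewrite mem_iota => /andP[_ lx]; rewrite height_vstr_columns.
Qed.

(** Only pairs whose second cell is an old car survive; since bottom labels are the smallest, every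
    close pair from a bottom cell to an old car counts. *)
Lemma tdinv_vstr_columns m n cols : 0 < m -> wf_columns m n cols ->
  tdinv m (n + m) (of_columns (vstr_columns m n cols)) =
  tdinv m n (of_columns cols) + close_above_bottoms m n (height cols).
Proof.
move=> m0 wf; have [sz pe srt H] := wf; have [sz' pe' _ _] := wf_vstr_columns wf.
rewrite !tdinv_of_columns //; set vcols := vstr_columns m n cols; set h := height cols.
pose F x t c s : nat := (label vcols x t < label vcols c s) &&
  close m (cell_rank m n x (hsum h x + t)) (cell_rank m n c (hsum h c + s)).
transitivity (\sum_(0 <= x < m) \sum_(0 <= t < (h x).+1)
    \sum_(0 <= c < m) \sum_(0 <= s < (h c).+1) F x t c s).
  apply: eq_big_nat => x /andP[_ lx]; rewrite height_vstr_columns //.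
  apply: eq_bigr => t _; apply: eq_big_nat => c /andP[_ lc].
  rewrite height_vstr_columns //; apply: eq_bigr => s _.
  by rewrite !cell_rank_vstr_columns // ltnW.
rewrite sum_cells_succ big_nat big1 ?add0n => [|x /andP[_ lx]]; last first.
  rewrite big_nat big1 // => t /andP[_ lt]; rewrite big_nat big1 // => c /andP[_ lc].
  rewrite /F label_vstr_columns0 //; case: t lt => [|t] lt.
    (* Between two bottom cells, a larger label means a rank no larger, so the pair is not close. *)
    rewrite label_vstr_columns0 // !addn0 ltnS; case: ltnP => //= le.
    have := bottom_order_ge lx lc (ltnW le).
    by rewrite !bottom_rankE // /close; case: ltgtP.
  rewrite label_vstr_columnsS //.
  have := index_bottom_order m n (of_columns cols).1 c; rewrite lc; case: ltnP => //; lia.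
rewrite addnC; congr addn.
  apply: eq_big_nat => x /andP[_ lx]; apply: eq_big_nat => t /andP[_ lt].
  apply: eq_big_nat => c /andP[_ lc]; apply: eq_big_nat => s /andP[_ ls].
  by rewrite /F !label_vstr_columnsS // ltn_add2r !addnS close_cell_rankS.
apply: eq_big_nat => x /andP[_ lx]; apply: eq_big_nat => c /andP[_ lc].
apply: eq_big_nat => s /andP[_ ls].
rewrite /F label_vstr_columnsS // label_vstr_columns0 // addn0.
have := index_bottom_order m n (of_columns cols).1 x; rewrite lx.
have := label_gt0 wf lc ls; case: ltnP => //; lia.
Qed.

Lemma car_rank_vstr m n cols i : 0 < m -> wf_columns m n cols -> 1 <= i <= n ->
  (car_rank m (n + m) (of_columns (vstr_columns m n cols)) (i + m) =
   car_rank m n (of_columns cols) i + m%:Z)%R.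
Proof.
move=> m0 wf hi; have [sz pe _ _] := wf; have [sz' pe' _ _] := wf_vstr_columns wf.
have /labelP[x [t [lx lt ->]]] : i \in flatten cols.
  by rewrite (perm_mem pe) mem_iota add1n ltnS.
have lxm : x < m by rewrite -sz.
rewrite -(label_vstr_columnsS n lxm lt) !car_rank_of_columns ?(perm_uniq pe) ?(perm_uniq pe')
  ?iota_uniq ?sz' ?height_vstr_columns //.
by rewrite cell_rank_vstr_columns ?(ltnW lxm) // !cell_rankD mulnS; lia.
Qed.

Lemma car_rank_bottom m n cols x : wf_columns m n cols -> x < m ->
  car_rank m (n + m) (of_columns (vstr_columns m n cols))
    (index x (bottom_order m n (of_columns cols).1)).+1 =
  bottom_rank m n (of_columns cols).1 x.
Proof.
move=> wf lx; have [sz pe _ _] := wf; have [sz' pe' _ _] := wf_vstr_columns wf.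
rewrite -(label_vstr_columns0 n cols lx) car_rank_of_columns ?(perm_uniq pe') ?iota_uniq ?sz'
  ?height_vstr_columns //.
by rewrite cell_rank_vstr_columns ?(ltnW lx) // addn0 bottom_rankE.
Qed.

Lemma bottom_order_mem m n P i : i < m -> nth 0 (bottom_order m n P) i < m /\
  index (nth 0 (bottom_order m n P) i) (bottom_order m n P) = i.
Proof.
move=> lt; rewrite index_uniq ?size_bottom_order //; last first.
  by rewrite (perm_uniq (perm_bottom_order m n P)) iota_uniq.
split=> //; have : nth 0 (bottom_order m n P) i \in bottom_order m n P.
  by rewrite mem_nth // size_bottom_order.
by rewrite (perm_mem (perm_bottom_order m n P)) mem_iota.
Qed.

(** Bottom ranks decrease, so no [i < m] occurs; old cars all gain [m] in rank, so their ascents are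
    shifted by [m]. *)
Lemma ides_vstr m n cols : 0 < m -> 0 < n -> wf_columns m n cols ->
  ides m (n + m) (of_columns (vstr_columns m n cols)) =
  m :: [seq i + m | i <- ides m n (of_columns cols)].
Proof.
move=> m0 n0 wf; have [sz pe _ _] := wf.
set R := car_rank m (n + m) (of_columns (vstr_columns m n cols)).
have bot i : i < m -> exists x, [/\ x < m,
    index x (bottom_order m n (of_columns cols).1) = i
    & R i.+1 = bottom_rank m n (of_columns cols).1 x].
  move=> /(bottom_order_mem n (of_columns cols).1)[lx e].
  by exists (nth 0 (bottom_order m n (of_columns cols).1) i); rewrite -car_rank_bottom // e.
rewrite /ides (_ : (n + m).-1 = m.-1 + (1 + n.-1)); last by lia.
rewrite iotaD filter_cat [X in X ++ _](_ : _ = [::]); last first.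
  apply/eqP; rewrite -[_ == _]negbK -has_filter -all_predC; apply/allP => -[|i].
    by rewrite mem_iota.
  rewrite mem_iota -/R => /andP[_ lt] /=.
  have [|x [lx ix ->]] := bot i; first by lia.
  have [|y [ly iy ->]] := bot i.+1; first by lia.
  rewrite -leNgt; apply: bottom_order_ge => //; lia.
rewrite iotaD filter_cat cat0s add1n prednK // /= -/R.
(* Car [m] has the smallest bottom rank, which is at most the rank 0 of the foot of column 0,
   whereas the old car 1 has rank at least [m]. *)
have -> : (R m < R m.+1)%R.
  have [|x [lx ix e]] := bot m.-1; first by lia.
  rewrite prednK // in e; rewrite -[m.+1]add1n {2}/R car_rank_vstr // ?n0 // e.
  have : (bottom_rank m n (of_columns cols).1 x <=
          bottom_rank m n (of_columns cols).1 0)%R.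
    apply: bottom_order_ge => //; rewrite ix -ltnS prednK //.
    by rewrite index_bottom_order.
  rewrite [X in (_ <= X)%R]bottom_rankE // hsum0 /cell_rank !muln0 mul0n div0n.
  have /labelP[y [t [ly lt ->]]] : 1 \in flatten cols.
    by rewrite (perm_mem pe) mem_iota; lia.
  rewrite car_rank_of_columns ?(perm_uniq pe) ?iota_uniq //.
  have := cell_rank_ge0 wf t (ltnW _ : y <= m); rewrite -sz => /(_ ly).
  by rewrite sz; lia.
congr cons; rewrite (_ : iota _ n.-1 = [seq i + m | i <- iota 1 n.-1]); last first.
  by rewrite iotaDl; apply: eq_map => i; rewrite addnC.
rewrite filter_map; congr map; apply: eq_in_filter => i; rewrite mem_iota => hi /=.
by rewrite -addSn /R !car_rank_vstr ?ltrD2r //; lia.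
Qed.

Lemma pairmap_subn_shift a m s :
  pairmap (fun a b => b - a) (a + m) [seq i + m | i <- s] = pairmap (fun a b => b - a) a s.
Proof. by elim: s a => //= b s IH a; rewrite subnDr IH. Qed.

Lemma pides_vstr m n cols : 0 < m -> 0 < n -> wf_columns m n cols ->
  pides m (n + m) (of_columns (vstr_columns m n cols)) =
  m :: pides m n (of_columns cols).
Proof.
move=> m0 n0 wf; rewrite /pides ides_vstr //= subn0; congr cons.
by rewrite -(map_rcons (addn^~ m)) -(pairmap_subn_shift 0 m).
Qed.

(** Parts are listed in decreasing order, so an extra part [m] comes first. *)
Lemma composition_of_succ m (alpha : nat -> nat) : 0 < m ->
  composition_of m (fun i => if i == m then (alpha m).+1 else alpha i) =
  m :: composition_of m alpha.
Proof.
case: m => // m _; rewrite /composition_of -addn1 iotaD rev_cat /= add1n addn1.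
rewrite eqxx /=; congr (_ :: (_ ++ flatten _)); apply/eq_in_map => i.
by rewrite mem_rev mem_iota; case: eqP => // ->; lia.
Qed.

Lemma columns_vstr_columns m n cols :
  columns m (of_columns (vstr_columns m n cols)) = vstr_columns m n cols.
Proof. by rewrite -[X in columns X](size_vstr_columns m n cols) columns_of_columns. Qed.

Lemma vstr_columns_inj m n cols cols' : size cols = m -> size cols' = m ->
  vstr_columns m n cols = vstr_columns m n cols' -> cols = cols'.
Proof.
move=> sz sz' e; apply: (@eq_from_nth _ [::]); rewrite sz ?sz' // => x lx.
have := f_equal (fun c => nth [::] c x) e; rewrite !nth_vstr_columns // => -[_].
by apply: inj_map => a b /addIn.
Qed.

(** * Removing the bottom cars: the inverse of [vstr] *)

Section Inverse.

Variables (m n : nat) (vcols : seq (seq nat)) (w : seq nat).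
Hypotheses (m0 : 0 < m) (n0 : 0 < n) (wf : wf_columns m (n + m) vcols).
Hypothesis pd : pides m (n + m) (of_columns vcols) = m :: w.

Let R := car_rank m (n + m) (of_columns vcols).
Let k := height vcols.

(** A first part [m] makes [m] the least ascent, so ranks never increase among the cars 1 to [m]. *)
Lemma small_ranks i j : 1 <= i -> i <= j -> j <= m -> (R j <= R i)%R.
Proof.
have dec i' : 1 <= i' -> i' < m -> (R i'.+1 <= R i')%R.
  move=> l1 lm; rewrite leNgt; apply/negP => lt.
  have : i' \in ides m (n + m) (of_columns vcols).
    by rewrite mem_filter -/R lt mem_iota l1 /=; lia.
  have : sorted ltn (ides m (n + m) (of_columns vcols)).
    rewrite /ides; apply: sorted_filter; first exact: ltn_trans.
    exact: iota_ltn_sorted.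
  move: pd; rewrite /pides; case: (ides _ _ _) => [|b s] //=.
  rewrite subn0 => -[-> _] /(order_path_min ltn_trans)/allP mn.
  rewrite inE; case: eqP => [e|_ /= /mn]; lia.
move=> i1; elim: j => [|j IH]; first by lia.
rewrite leq_eqVlt => /orP[/eqP->//|lij] lj.
by apply: le_trans (dec j _ lj) (IH _ (ltnW lj)); lia.
Qed.

Lemma vcols_uniq : uniq (flatten vcols).
Proof. by case: wf => _ pe _ _; rewrite (perm_uniq pe) iota_uniq. Qed.

Lemma label_sorted x t s : x < m -> s < k x -> t < s ->
  label vcols x t < label vcols x s.
Proof.
case: wf => sz _ srt _ lx ls lts.
have /all_nthP/(_ x) := srt; rewrite sz => /(_ [::] lx) sx.
by apply: (sorted_ltn_nth ltn_trans 0 sx) => //; rewrite inE ?(ltn_trans lts).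
Qed.

(** Within a column ranks increase with the labels, against [small_ranks]. *)
Lemma small_label_uniq x t s : x < m -> t < k x -> s < k x ->
  label vcols x t <= m -> label vcols x s <= m -> t = s.
Proof.
wlog lts : t s / t < s => [hw|] lx lt ls lm lm'.
  case: (ltngtP t s) => // lts; first exact: hw.
  by apply/esym; exact: hw.
have := small_ranks (label_gt0 wf lx lt) (ltnW (label_sorted lx ls lts)) lm'.
case: wf => sz _ _ _; rewrite /R !car_rank_of_columns ?vcols_uniq ?sz //.
by rewrite !cell_rankD; nia.
Qed.

Let col i := find (fun c => i \in c) vcols.

Lemma colP i : 1 <= i <= m -> exists t, [/\ col i < m, t < k (col i) & i = label vcols (col i) t].
Proof.
case: wf => sz pe _ _ hi.
have : i \in flatten vcols by rewrite (perm_mem pe) mem_iota; lia.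
case/flattenP => c cin ic.
have hs : has (fun c => i \in c) vcols by apply/hasP; exists c.
have := nth_find [::] hs; rewrite -/(col i) => /(nthP 0)[t lt et].
by exists t; split; [rewrite -[X in _ < X]sz -has_find | exact: lt | rewrite /label et].
Qed.

(** The [m] small cars lie in distinct columns, and there are only [m] columns. *)
Lemma perm_col : perm_eq [seq col i | i <- iota 1 m] (iota 0 m).
Proof.
have us : uniq [seq col i | i <- iota 1 m].
  rewrite map_inj_in_uniq ?iota_uniq // => i j; rewrite !mem_iota add1n !ltnS => hi hj e.
  have [t [lx lt ei]] := colP hi; have [s [ly ls ej]] := colP hj.
  have ts : t = s.
    apply: (small_label_uniq lx) => //; first by rewrite e.
      by rewrite -ei; case/andP: hi.
    by rewrite e -ej; case/andP: hj.
  by rewrite ei ej e ts.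
apply: uniq_perm => //; first exact: iota_uniq.
apply: (uniq_min_size us _ _).2; last by rewrite size_map !size_iota.
move=> x /mapP[i]; rewrite mem_iota add1n ltnS => /colP[t [lx _ _]] ->.
by rewrite mem_iota.
Qed.

(** Each column holds a small car; a car below it would be a second small one. *)
Lemma bottom_label x : x < m ->
  [/\ 0 < k x, 1 <= label vcols x 0 <= m & col (label vcols x 0) = x].
Proof.
move=> lx; have : x \in [seq col i | i <- iota 1 m] by rewrite (perm_mem perm_col) mem_iota.
case/mapP => i; rewrite mem_iota add1n ltnS => hi ex.
have [t [_ lt ei]] := colP hi; rewrite -ex in lt ei.
have k0 : 0 < k x by apply: leq_ltn_trans lt.
have t0 : t = 0.
  case: t ei lt => // t ei lt; have := label_sorted lx lt (ltn0Sn t) => l0.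
  by apply: (small_label_uniq lx) => //; lia.
by rewrite t0 in ei; rewrite -ei -ex; split.
Qed.

Lemma upper_label x t : x < m -> t.+1 < k x -> m < label vcols x t.+1.
Proof.
move=> lx lt; rewrite ltnNge; apply/negP => le.
have [k0 /andP[_ l0] _] := bottom_label lx.
by have := small_label_uniq lx lt k0 le l0.
Qed.

Definition unvstr_columns := [seq [seq i - m | i <- behead c] | c <- vcols].

Lemma size_unvstr_columns : size unvstr_columns = m.
Proof. by case: wf => sz _ _ _; rewrite size_map. Qed.

Lemma nth_unvstr_columns x : x < m ->
  nth [::] unvstr_columns x = [seq i - m | i <- behead (nth [::] vcols x)].
Proof. by case: wf => sz _ _ _ lx; rewrite (nth_map [::]) ?sz. Qed.

Lemma height_unvstr_columns x : x < m -> k x = (height unvstr_columns x).+1.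
Proof.
move=> lx; rewrite /height nth_unvstr_columns // size_map size_behead prednK //.
by case: (bottom_label lx).
Qed.

Lemma label_unvstr_columns x t : x < m -> t.+1 < k x ->
  label unvstr_columns x t = label vcols x t.+1 - m.
Proof.
move=> lx lt; rewrite /label nth_unvstr_columns // (nth_map 0) ?nth_behead //.
by rewrite size_behead -/(height _ _) -ltnS prednK //; case: (bottom_label lx).
Qed.

Lemma hsum_unvstr_columns x : x <= m -> hsum k x = hsum (height unvstr_columns) x + x.
Proof.
move=> le; rewrite -hsum_succ; apply: eq_hsum => y ly.
by rewrite height_unvstr_columns // (leq_trans ly).
Qed.

Lemma vcols_cons :
  vcols = [seq label vcols x 0 :: behead (nth [::] vcols x) | x <- iota 0 m].
Proof.
case: wf => sz _ _ _; apply: (@eq_from_nth _ [::]); rewrite ?size_map ?size_iota // sz => x lx.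
rewrite (nth_map 0) ?size_iota // nth_iota // add0n /label.
by have [] := bottom_label lx; rewrite /k /height; case: (nth [::] vcols x).
Qed.

Lemma wf_unvstr_columns : wf_columns m n unvstr_columns.
Proof.
have [sz pe srt H] := wf; split.
- exact: size_unvstr_columns.
- have fl : flatten unvstr_columns = [seq i - m | i <- flatten (map behead vcols)].
    by rewrite map_flatten -map_comp.
  (* The cars left after removing the bottoms are exactly those above [m]. *)
  have : perm_eq (filter (ltn m) (flatten vcols)) (flatten (map behead vcols)).
    have -> : map behead vcols = [seq behead (nth [::] vcols x) | x <- iota 0 m].
      by rewrite {1}vcols_cons -map_comp.
    rewrite {1}vcols_cons (perm_trans (perm_filter _ (perm_flatten_cons _ _ _))) //.
    rewrite filter_cat (_ : filter _ (map _ _) = [::]) ?cat0s; last first.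
      apply/eqP; rewrite -[_ == _]negbK -has_filter -all_predC; apply/allP => y /mapP[x].
      rewrite mem_iota => /andP[_ lx] -> /=.
      by case: (bottom_label lx) => _ /andP[_]; rewrite -leqNgt.
    rewrite (_ : filter _ _ = flatten [seq behead (nth [::] vcols x) | x <- iota 0 m]) //.
    apply/all_filterP/allP => i /flatten_mapP[x]; rewrite mem_iota => /andP[_ lx].
    move=> /(nthP 0)[t]; rewrite size_behead nth_behead ltn_predRL => lt <-.
    exact: upper_label.
  move=> pf; rewrite fl.
  have pm := perm_map (subn^~ m) pf; rewrite perm_sym in pm; apply: perm_trans pm _.
  apply: perm_trans (perm_map _ (perm_filter _ pe)) _.
  rewrite addnC iotaD filter_cat (_ : filter _ (iota 1 m) = [::]) ?cat0s; last first.
    apply/eqP; rewrite -[_ == _]negbK -has_filter -all_predC; apply/allP => i.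
    by rewrite mem_iota /=; lia.
  rewrite (_ : filter _ _ = iota (1 + m) n); last first.
    by apply/all_filterP/allP => i; rewrite mem_iota /=; lia.
  rewrite [1 + m]addnC iotaDl -map_comp map_id_in // => i _ /=.
  by rewrite addKn.
- apply/(all_nthP [::]) => x; rewrite size_unvstr_columns => lx; apply/(sortedP 0) => t lt.
  change (label unvstr_columns x t < label unvstr_columns x t.+1).
  have lt' : t.+2 < k x by rewrite height_unvstr_columns.
  rewrite !label_unvstr_columns ?(ltnW lt') //.
  have := label_sorted lx lt' (ltnSn _); have := upper_label lx (ltnW lt'); lia.
- move=> x le; have := H x le; rewrite -/k hsum_unvstr_columns //.
  by rewrite mulnDl mulnDr leq_add2r.
Qed.

(** The point is that [vstr] gives the removed labels back. The columns of cars 1 to [m] are already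
    sorted by decreasing bottom rank, and distinct columns have distinct ranks, so this list is
    [bottom_order]. *)
Lemma unvstr_columnsK : vstr_columns m n unvstr_columns = vcols.
Proof.
have wfu := wf_unvstr_columns; have [sz _ _ _] := wf.
have [szu _ _ _] := wfu.
have br x : x < m -> bottom_rank m n (of_columns unvstr_columns).1 x = R (label vcols x 0).
  move=> lx; have [k0 _ _] := bottom_label lx.
  rewrite bottom_rankE // /R car_rank_of_columns ?vcols_uniq ?sz // -/k.
  by rewrite hsum_unvstr_columns ?(ltnW lx) // addn0 cell_rank_addn.
pose r x x' := (bottom_rank m n (of_columns unvstr_columns).1 x' <=
                bottom_rank m n (of_columns unvstr_columns).1 x)%R.
have Rcol i : 1 <= i <= m -> label vcols (col i) 0 = i.
  move=> hi; have [t [lx lt ei]] := colP hi; rewrite [RHS]ei; congr label.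
  have [k0 /andP[_ l0] _] := bottom_label lx.
  by apply: (small_label_uniq lx) => //; rewrite -ei; case/andP: hi.
have ebo : bottom_order m n (of_columns unvstr_columns).1 = [seq col i | i <- iota 1 m].
  apply: (@sorted_eq_in _ r).
  - by move=> a b c _ _ _ /= ab bc; exact: le_trans bc ab.
  - move=> a b; rewrite !mem_sort !mem_iota => /andP[_ la] /andP[_ lb].
    rewrite /r -eq_le !bottom_rankE // => /eqP e.
    exact: cell_rank_inj m0 la lb (esym e).
  - by apply: sort_sorted => a b /=; exact: le_total.
  - rewrite sorted_map; apply/(sortedP 0) => i; rewrite size_iota => lt.
    rewrite !nth_iota ?(ltnW lt) //= /r.
    have h1 : 1 <= 1 + i <= m by lia.
    have h2 : 1 <= 1 + i.+1 <= m by lia.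
    have [_ [l1 _ _]] := colP h1; have [_ [l2 _ _]] := colP h2.
    rewrite !br // !Rcol //; apply: small_ranks; lia.
  - by rewrite (perm_trans (perm_bottom_order _ _ _)) // perm_sym perm_col.
rewrite [RHS]vcols_cons; apply/eq_in_map => x; rewrite mem_iota => /andP[_ lx].
have [k0 hx ex] := bottom_label lx; congr cons.
  have uc : uniq [seq col i | i <- iota 1 m] by rewrite (perm_uniq perm_col) iota_uniq.
  rewrite ebo; have := @index_uniq _ 0 (label vcols x 0).-1 _ _ uc.
  rewrite size_map size_iota (nth_map 0) ?size_iota ?nth_iota; try by lia.
  by rewrite add1n prednK ?ex => [->|]; lia.
rewrite nth_unvstr_columns // -map_comp map_id_in // => i /(nthP 0)[t].
rewrite size_behead nth_behead ltn_predRL => lt <- /=; rewrite subnK //.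
exact/ltnW/upper_label.
Qed.

End Inverse.

Theorem theorem9 (m n : nat) (alpha : nat -> nat)
  (m_gt0 : 0 < m) (n_gt0 : 0 < n)
  (alpha_n : \sum_(1 <= i < m.+1) i * alpha i = n) :
  set_bij
    [set pi | parking m n pi /\ pides m n pi = composition_of m alpha]
    [set pi | parking m (n + m) pi /\
       pides m (n + m) pi =
         composition_of m (fun i => if i == m then (alpha m).+1 else alpha i)]
    (vstr m n)
  /\ forall pi : labelled_path, parking m n pi ->
     [/\ area m (n + m) (vstr m n pi).1 = area m n pi.1,
         dinv m (n + m) (vstr m n pi) = dinv m n pi
       & ret m (n + m) (vstr m n pi).1 = ret m n pi.1].
Proof.
rewrite composition_of_succ //; split; first split.
- move=> pi [/(parking_cols m_gt0)[epi wf] pd]; have [sz _ _ _] := wf.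
  rewrite epi vstr_of_columns //; split.
    exact/parking_of_columns/wf_vstr_columns.
  by rewrite pides_vstr // -epi pd.
- move=> pi rho; rewrite !inE => -[/(parking_cols m_gt0)[epi wf] _].
  move=> [/(parking_cols m_gt0)[erho wf'] _].
  have [[sz _ _ _] [sz' _ _ _]] := (wf, wf').
  rewrite epi erho !vstr_of_columns // => /(f_equal (columns m)).
  by rewrite !columns_vstr_columns => /(vstr_columns_inj sz sz')->.
- move=> pi [/(parking_cols m_gt0)[epi wf] pd]; rewrite epi in pd.
  have wfu := wf_unvstr_columns m_gt0 n_gt0 wf pd.
  have eK := unvstr_columnsK m_gt0 n_gt0 wf pd.
  exists (of_columns (unvstr_columns m (columns m pi))); last first.
    by rewrite vstr_of_columns ?eK -?epi //; case: wfu.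
  split; first exact: parking_of_columns.
  by have := pides_vstr m_gt0 n_gt0 wfu; rewrite eK pd => -[].
move=> pi pk; have [epi wf] := parking_cols m_gt0 pk; move: pk.
set cols := columns m pi in epi wf *; rewrite {}epi => pk.
have [sz pe _ H] := wf; have wfv := wf_vstr_columns wf.
have eN : norths (of_columns cols).1 = stairs (height cols) m.
  by rewrite norths_of_columns sz.
have eN' := norths_vstr m n cols.
have hm : hsum (height cols) m = n.
  by rewrite -sz -size_flatten_cols (perm_size pe) size_iota.
rewrite vstr_of_columns //; split.
- exact: area_stairs_succ hm eN eN'.
- rewrite /dinv tdinv_vstr_columns // !maxdinv_of_columns //.
  rewrite (pdinv_stairs_succ n_gt0 eN eN' H).
  have -> : close_pairs m (n + m) (height (vstr_columns m n cols)) =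
            close_pairs m (n + m) (fun x => (height cols x).+1).
    by apply: eq_close_pairs => x lx; rewrite height_vstr_columns.
  (* The gain of [maxdinv] is the sum of the gains of [tdinv] and [pdinv], so [dinv] is
     unchanged. *)
  rewrite close_pairs_succ; lia.
- apply: ret_stairs_succ eN eN' => //; first by case/and3P: pk.
  by case/and3P: (parking_of_columns wfv).
Qed.
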